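(* Let $\mathcal{M}'': z(u,v)=f(u)\,l(v)+g(u)\,e_4$, $u\in I$, $v\in J$, be a meridian surface of type $\mathcal{M}''$ in $\mathbb{E}^4_2$ (so $l$ is a unit-speed curve on $\mathbb{H}^2_1(-1)\subset\mathbb{E}^3_1$ and $f'^2+g'^2=1$). Then $\mathcal{M}''$ is quasi-minimal if and only if the curve $l$ has constant curvature $\kappa=a=\mathrm{const}$, $a\neq0$, and the meridian curve $u\mapsto(f(u),g(u))$ is determined by $f'=\varphi(f)$, where $$\varphi(t)=\pm\frac1t\sqrt{t^2-(c\pm at)^2},\qquad c=\mathrm{const},$$ and $g(u)$ is defined by $g'=\sqrt{1-f'^2}$.
   Context: $\mathbb{E}^4_2$ is $\mathbb{R}^4$ with the inner product $\langle x,y\rangle=x_1y_1+x_2y_2-x_3y_3-x_4y_4$ and standard basis $e_1,e_2,e_3,e_4$. Let $\mathbb{E}^3_1=\mathrm{span}\{e_1,e_2,e_3\}$ and $\mathbb{H}^2_1(-1)=\{V\in\mathbb{E}^3_1:\langle V,V\rangle=-1\}$ (curves are taken in the part parametrized by $\sinh w^1\cos w^2\,e_1+\sinh w^1\sin w^2\,e_2+\cosh w^1\,e_3$). Meridian surface of type $\mathcal{M}''$: let $I,J\subset\mathbb{R}$ be intervals, $f,g:I\to\mathbb{R}$ smooth with $f$ nowhere zero, $f'^2+g'^2=1$ and $g'>0$; let $l:J\to\mathbb{H}^2_1(-1)$ be a smooth curve with $\langle l',l'\rangle=1$. The surface is $z(u,v)=f(u)l(v)+g(u)e_4$. Its induced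 metric is Lorentzian, with orthonormal tangent frame $X=z_u$, $Y=z_v/f=l'$, $\langle X,X\rangle=-1$, $\langle Y,Y\rangle=1$. Curvature of $l$: put $t=l'$ and let $n$ be a vector field along $l$ (unique up to sign) such that $\{l,t,n\}$ is an orthonormal frame of $\mathbb{E}^3_1$ with $\langle l,l\rangle=-1$, $\langle t,t\rangle=\langle n,n\rangle=1$; then $\kappa(v)=\langle t'(v),n(v)\rangle$, so that $t'=\kappa n+l$, $n'=-\kappa t$. For a Lorentz surface with second fundamental form $h$, the mean curvature vector field is $H=\tfrac12\,\mathrm{tr}\,h=\tfrac12\left(h(E_1,E_1)-h(E_2,E_2)\right)$ for any local orthonormal tangent frame with $\langle E_1,E_1\rangle=1$, $\langle E_2,E_2\rangle=-1$. The surface is quasi-minimal if $H$ is lightlike at each point, i.e. $H\neq0$ and $\langle H,H\rangle=0$. ''$f'=\varphi(f)$'' means $f'(u)=\varphi(f(u))$.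
   Formalization: When c≠0 it is also required that f' is not identically zero (else ''if'' fails, e.g. a=2, c=-1, f=1, g=u); the outer sign ± in φ may change along I, at turning points of f (a fixed sign makes ''only if'' false); the radicand must be nonnegative. *)

(* Defs.v *)
From mathcomp Require Import all_boot all_order all_algebra.
From mathcomp Require Import all_classical all_reals all_analysis.
Set Implicit Arguments.
Unset Strict Implicit.
Unset Printing Implicit Defensive.
Import Order.TTheory GRing.Theory Num.Theory numFieldNormedType.Exports.
Local Open Scope ring_scope.
Local Open Scope classical_set_scope.

(** * Calculus on intervals *)

(* Intervals may be open, closed, half-open, bounded or unbounded, but have
   nonempty interior. *)
Definition nondeg_interval (R : realType) (I : set R) : Prop :=
  is_interval I /\ exists x y, [/\ I x, I y & x < y].

(* Smoothness on a set A that need not be open means smoothness on an open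
   neighbourhood of A, so the derivatives below are ordinary two-sided
   derivatives at every point of A, endpoints included. *)
Definition smooth_on (R : realType) (V : normedModType R) (A : set R)
    (f : R -> V) : Prop :=
  exists U : set R, [/\ open U, A `<=` U &
    forall (k : nat) (x : R), U x -> derivable (derive1n k f) x 1].

(** * The neutral space E^4_2 *)

Notation E42 R := 'rV[R]_4.

(* Indices are shifted by one: the coordinate x_i is [x 0 (i - 1)]. *)
Definition ip (R : realType) (x y : E42 R) : R :=
  x 0 0 * y 0 0 + x 0 1 * y 0 1 - x 0 2 * y 0 2 - x 0 3 * y 0 3.

Definition e1 (R : realType) : E42 R := delta_mx 0 0.
Definition e2 (R : realType) : E42 R := delta_mx 0 1.
Definition e3 (R : realType) : E42 R := delta_mx 0 2.
Definition e4 (R : realType) : E42 R := delta_mx 0 3.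

Definition lightlike (R : realType) (x : E42 R) : Prop :=
  x <> 0 /\ ip x x = 0.

Definition E31 (R : realType) : set (E42 R) :=
  [set x | exists a b c : R, x = a *: e1 R + b *: e2 R + c *: e3 R].

Definition sinh (R : realType) (w : R) : R := (expR w - expR (- w)) / 2.
Definition cosh (R : realType) (w : R) : R := (expR w + expR (- w)) / 2.

Definition H21 (R : realType) : set (E42 R) :=
  [set x | E31 x /\ ip x x = -1].

(* The part of H^2_1(-1) in which the curves are taken (one of its sheets). *)
Definition H21_part (R : realType) : set (E42 R) :=
  [set x | H21 x /\ exists w1 w2 : R,
    x = (sinh w1 * cos w2) *: e1 R + (sinh w1 * sin w2) *: e2 R
        + cosh w1 *: e3 R].

(** * Surfaces in E^4_2 *)

Section Surface.
Variable R : realType.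
Implicit Types (z : R -> R -> E42 R) (u v : R) (X Y : R * R) (w nu H : E42 R).

Definition pdu z : R -> R -> E42 R := fun u v => derive1 (fun s => z s v) u.
Definition pdv z : R -> R -> E42 R := fun u v => derive1 (fun s => z u s) v.

(* A pair X stands for the tangent vector X.1 z_u + X.2 z_v. *)
Definition tangent z u v X : E42 R := X.1 *: pdu z u v + X.2 *: pdv z u v.

(* Ambient derivative D_X Y when X and Y are extended with constant
   coordinates in the frame z_u, z_v. *)
Definition ambient_deriv z u v X Y : E42 R :=
  (X.1 * Y.1) *: pdu (pdu z) u v + (X.1 * Y.2 + X.2 * Y.1) *: pdu (pdv z) u v
  + (X.2 * Y.2) *: pdv (pdv z) u v.

Definition normal_vector z u v nu : Prop :=
  forall X, ip nu (tangent z u v X) = 0.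

(* [nu] is h(X, Y), by the Gauss formula D_X Y = nabla_X Y + h(X, Y) with
   nabla_X Y tangent and h(X, Y) normal. *)
Definition second_fundamental_form z u v X Y nu : Prop :=
  normal_vector z u v nu /\
  exists W : R * R, ambient_deriv z u v X Y = tangent z u v W + nu.

Definition lorentz_frame z u v (E1 E2 : R * R) : Prop :=
  [/\ ip (tangent z u v E1) (tangent z u v E1) = 1,
      ip (tangent z u v E2) (tangent z u v E2) = -1 &
      ip (tangent z u v E1) (tangent z u v E2) = 0].

(* The existence of a Lorentz frame makes the tangent plane nondegenerate, so
   at most one vector is related to z, u, v. *)
Definition mean_curvature_vector z u v H : Prop :=
  exists (E1 E2 : R * R) (h1 h2 : E42 R),
    [/\ lorentz_frame z u v E1 E2,
        second_fundamental_form z u v E1 E1 h1,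
        second_fundamental_form z u v E2 E2 h2 &
        H = 2^-1 *: (h1 - h2)].

Definition quasi_minimal (I J : set R) z : Prop :=
  forall u v, I u -> J v -> exists2 H, mean_curvature_vector z u v H & lightlike H.

End Surface.

(** * Meridian surfaces of type M'' *)

Definition meridian_curve (R : realType) (I : set R) (f g : R -> R) : Prop :=
  [/\ smooth_on I (f : R -> R^o), smooth_on I (g : R -> R^o) &
      forall u, I u ->
        [/\ f u != 0, (derive1 f u) ^+ 2 + (derive1 g u) ^+ 2 = 1 & 0 < derive1 g u]].

Definition unit_speed_curve (R : realType) (J : set R) (l : R -> E42 R) : Prop :=
  smooth_on J l /\
  forall v, J v -> H21_part (l v) /\ ip (derive1 l v) (derive1 l v) = 1.

(* n completes l and t = l' to an orthonormal frame of E^3_1 along l; the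
   relations between l and t follow from [unit_speed_curve]. *)
Definition unit_normal_field (R : realType) (J : set R) (l n : R -> E42 R) :
    Prop :=
  smooth_on J n /\
  forall v, J v ->
    [/\ E31 (n v), ip (n v) (n v) = 1, ip (n v) (l v) = 0 &
        ip (n v) (derive1 l v) = 0].

Definition curvature (R : realType) (l n : R -> E42 R) (v : R) : R :=
  ip (derive1n 2 l v) (n v).

Definition meridian_surface (R : realType) (f g : R -> R) (l : R -> E42 R) :
    R -> R -> E42 R :=
  fun u v => f u *: l v + g u *: e4 R.

(* phi(t) = +- (1/t) sqrt (t^2 - (c +- a t)^2); the booleans select the outer
   and the inner sign, [false] being +.  The library square root vanishes at
   negative arguments, so the radicand is named to let its nonnegativity be
   required. *)
Definition radicand (R : realType) (inner : bool) (a c t : R) : R :=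
  t ^+ 2 - (c + (-1) ^+ inner * (a * t)) ^+ 2.

Definition phi (R : realType) (outer inner : bool) (a c t : R) : R :=
  (-1) ^+ outer * (t^-1 * Num.sqrt (radicand inner a c t)).

(* The meridian curve determined by f' = phi(f), g' = sqrt (1 - f'^2).
   - The inner sign is fixed along the curve.  The outer one may depend on u: it
     switches where f has a turning point, i.e. where phi(f) = 0.
   - For c <> 0 the zeros of phi are isolated and are equilibria of f' = phi(f);
     these are spurious constant solutions (the surface is then quasi-minimal
     iff |a| = 1, whatever c is), and the last clause discards them.  For
     c = 0, f' is constant and no solution is discarded; the constant f with
     |a| = 1 are obtained here. *)
Definition meridian_determined_by_phi (R : realType) (I : set R) (f g : R -> R)
    (a : R) : Prop :=
  exists (c : R) (inner : bool),
    [/\ forall u, I u -> 0 <= radicand inner a c (f u) /\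
          exists outer : bool, derive1 f u = phi outer inner a c (f u),
        forall u, I u -> derive1 g u = Num.sqrt (1 - (derive1 f u) ^+ 2) &
        c != 0 -> exists2 u, I u & derive1 f u != 0].

(* Main.v *)
(* With N = g' l - f' e4, so that <n, n> = 1 and <N, N> = -1, the mean curvature
   vector is H = (kappa n + G N) / (2 f), where G = g' - f (f'' g' - f' g'')
   depends on u only.  Hence the surface is quasi-minimal iff
   kappa(v)^2 = G(u)^2 <> 0 for all u and v, which forces kappa and G to be
   constant.  Since (f g')' = f' G, the equation G = +-a integrates to
   f g' = c +- a f, and f'^2 = 1 - g'^2 turns this into f' = phi(f). *)
Require Import Defs.
From mathcomp Require Import all_boot all_order all_algebra.
From mathcomp Require Import all_classical all_reals all_analysis.
From mathcomp Require Import ring lra.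
Import Order.TTheory GRing.Theory Num.Theory numFieldNormedType.Exports.
Local Open Scope ring_scope.
Local Open Scope classical_set_scope.
Set Implicit Arguments.
Unset Strict Implicit.
Unset Printing Implicit Defensive.

(** * Calculus on intervals *)

Lemma smooth_onP (R : realType) (V : normedModType R) (A : set R) (f : R -> V) :
  smooth_on A f -> exists2 U : set R, open U /\ A `<=` U &
    forall k x, U x -> is_derive x 1 (derive1n k f) (derive1n k.+1 f x).
Proof.
move=> [U [oU AU df]]; exists U => // k x Ux; apply: DeriveDef; first exact: df.
by rewrite derive1nS derive1E.
Qed.

(** [I] need not be a neighbourhood of [x], which may be an endpoint. Carathéodory's slope [k] is
    continuous at [x] with [k x = d]; if [d] were nonzero, [h y] would differ from [h x] at every
    [y != x] close to [x], and [I] contains such points. *)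
Lemma is_derive_within_cst (R : realType) (I : set R) (h : R -> R) (x d : R) :
  nondeg_interval I -> I x -> is_derive x 1 h d ->
  (\forall y \near x, I y -> h y = h x) -> d = 0.
Proof.
move=> [intI [y0 [y1 [Iy0 Iy1 y01]]]] Ix /is_derive1_caratheodory[k [hk kx <-]] hx.
apply/eqP/negPn/negP => k0.
have [e /= e0 he] : exists2 e : R, 0 < e & forall y, `|x - y| < e ->
    (I y -> h y = h x) /\ k y != 0.
  have : \forall y \near x, (I y -> h y = h x) /\ k y != 0.
    have hk0 : \forall y \near x, k y != 0 by exact: (cvgr_neq0 _ kx k0).
    by apply: filterS2 hx hk0.
  by case=> e /= e0 he; exists e.
have [y Iy yx] : exists2 y, I y & y != x.
  by have [<-|] := eqVneq y0 x; [exists y1; rewrite // gt_eqF|exists y0].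
(* [s <= 1] keeps [z] on the segment from [x] to [y], hence in [I]; [0 < s] keeps it off [x]; the
   second argument of the minimum puts it within [e / 2] of [x]. *)
pose s := Num.min 1 (e / 2 / `|y - x|).
have yx0 : 0 < `|y - x| by rewrite normr_gt0 subr_eq0.
have s0 : 0 < s by rewrite lt_min ltr01 !divr_gt0.
have s1 : s <= 1 by rewrite ge_min lexx.
pose z := x + s * (y - x).
have Iz : I z.
  have [xy|yx'] := leP x y.
    by apply: (intI x y) => //; rewrite /z; apply/andP; split; nra.
  by apply: (intI y x) => //; rewrite /z; apply/andP; split; nra.
have [] := he z.
  rewrite /z opprD addNKr normrN normrM (gtr0_norm s0).
  rewrite (@le_lt_trans _ _ (e / 2)) //; last by lra.
  by rewrite -ler_pdivlMr// ge_min lexx orbT.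
move=> /(_ Iz) hzx kz; have /eqP := hk z.
rewrite hzx subrr eq_sym mulf_eq0 (negPf kz) /= subr_eq0 /z -subr_eq0 addrAC subrr add0r.
by rewrite mulf_eq0 gt_eqF//= subr_eq0 (negPf yx).
Qed.

Lemma is_derive_on_cst (R : realType) (I : set R) (h : R -> R) (x d : R) :
  nondeg_interval I -> I x -> is_derive x 1 h d ->
  (forall y, I y -> h y = h x) -> d = 0.
Proof.
by move=> ? ? ? hx; apply: (@is_derive_within_cst _ I h x) => //; exact: filterE.
Qed.

Lemma within_continuous (R : realType) (I : set R) (h : R -> R) (x y : R) :
  is_interval I -> I x -> I y -> (forall z, I z -> {for z, continuous h}) ->
  {within `[x, y], continuous h}.
Proof.
move=> intI Ix Iy hc; apply: continuous_in_subspaceT => z.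
by rewrite inE /= in_itv /= => zxy; apply: hc; exact: (intI x y).
Qed.

Lemma derive_eq0_cst (R : realType) (I : set R) (h : R -> R) (x y : R) :
  is_interval I -> I x -> I y -> (forall z, I z -> is_derive z 1 h 0) -> h x = h y.
Proof.
move=> intI; wlog : x y / x <= y => [hw Ix Iy h0|].
  by have [/hw->//|/ltW yx] := leP x y; apply/esym/hw.
rewrite le_eqVlt => /predU1P[->//|xy] Ix Iy h0.
have [||c _] := @MVT R h (cst 0) x y xy.
- move=> z; rewrite in_itv/= => /andP[xz zy]; apply: h0.
  by apply: (intI x y) => //; rewrite !ltW.
- apply: (@within_continuous _ I) => // z /h0 [hz _].
  exact/differentiable_continuous/derivable1_diffP.
by rewrite mul0r => /eqP; rewrite subr_eq0 => /eqP.
Qed.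

(** If [h x] and [h y] differed, they would be [p] and [q] in some order, and the intermediate value
    theorem would produce their midpoint as a third value. *)
Lemma two_valued_cst (R : realType) (I : set R) (h : R -> R) (p q : R) :
  is_interval I -> (forall z, I z -> {for z, continuous h}) ->
  (forall z, I z -> h z = p \/ h z = q) ->
  forall x y, I x -> I y -> h x = h y.
Proof.
move=> intI hc hpq x y; wlog : x y / x <= y => [hw Ix Iy|xy Ix Iy].
  by have [/hw->//|/ltW yx] := leP x y; apply/esym/hw.
apply/eqP/negPn/negP => hxy.
have [] := @IVT R h x y ((h x + h y) / 2) xy.
- exact: (@within_continuous _ I).
- by rewrite ge_min le_max; have [hl|hl] := leP (h x) (h y);
    apply/andP; split; apply/orP; lra.
move=> c; rewrite in_itv /= => cxy hcE.
have := hpq c (intI x y Ix Iy c cxy); rewrite hcE.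
by have [] := hpq x Ix => hx; have [] := hpq y Iy => hy; move/eqP: hxy;
  rewrite hx hy => hxy [] hh; apply: hxy; lra.
Qed.

Lemma sqr_cst_cst (R : realType) (I : set R) (h : R -> R) (b : R) :
  is_interval I -> (forall z, I z -> {for z, continuous h}) ->
  (forall z, I z -> h z ^+ 2 = b) -> forall x y, I x -> I y -> h x = h y.
Proof.
move=> intI hc hb x y Ix; apply: (@two_valued_cst _ I _ (h x) (- h x)) => // z Iz.
have /eqP : h z ^+ 2 = h x ^+ 2 by rewrite !hb.
by rewrite eqf_sqr => /orP[] /eqP; [left|right].
Qed.

(** * The inner product and its derivatives *)

Lemma E42P (R : realType) (x y : E42 R) :
  x 0 0 = y 0 0 -> x 0 1 = y 0 1 -> x 0 2 = y 0 2 -> x 0 3 = y 0 3 -> x = y.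
Proof.
move=> h0 h1 h2 h3; apply/rowP => -[[|[|[|[|//]]]] i4].
- by rewrite (_ : Ordinal i4 = 0) //; exact: val_inj.
- by rewrite (_ : Ordinal i4 = 1) //; exact: val_inj.
- by rewrite (_ : Ordinal i4 = 2) //; exact: val_inj.
- by rewrite (_ : Ordinal i4 = 3) //; exact: val_inj.
Qed.

Lemma ipC (R : realType) (x y : E42 R) : ip x y = ip y x.
Proof. by rewrite /ip; ring. Qed.

Lemma ipDl (R : realType) (x y z : E42 R) : ip (x + y) z = ip x z + ip y z.
Proof. by rewrite /ip !mxE; ring. Qed.

Lemma ipZl (R : realType) (a : R) (x y : E42 R) : ip (a *: x) y = a * ip x y.
Proof. by rewrite /ip !mxE; ring. Qed.

Lemma ipNl (R : realType) (x y : E42 R) : ip (- x) y = - ip x y.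
Proof. by rewrite /ip !mxE; ring. Qed.

Lemma ipDr (R : realType) (x y z : E42 R) : ip x (y + z) = ip x y + ip x z.
Proof. by rewrite ipC ipDl !(ipC x). Qed.

Lemma ipZr (R : realType) (a : R) (x y : E42 R) : ip x (a *: y) = a * ip x y.
Proof. by rewrite ipC ipZl (ipC x). Qed.

Lemma ipNr (R : realType) (x y : E42 R) : ip x (- y) = - ip x y.
Proof. by rewrite ipC ipNl (ipC x). Qed.

Definition ipE := (ipDl, ipDr, ipNl, ipNr, ipZl, ipZr).

Lemma ip_e4 (R : realType) (x : E42 R) : ip (e4 R) x = - x 0 3.
Proof. by rewrite /ip /e4 !mxE /= !mul0r mul1r; ring. Qed.

Lemma E31_coord3 (R : realType) (x : E42 R) : E31 x -> x 0 3 = 0.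
Proof. by case=> a [b [c ->]]; rewrite /e1 /e2 /e3 !mxE /=; ring. Qed.

(* The square of the determinant of l, t, n is minus that of their Gram matrix,
   so l, t, n span E^3_1; Cramer's rule then kills the difference of both sides. *)
Lemma orthonormal_expansion (R : realType) (l t n x : E42 R) :
  l 0 3 = 0 -> t 0 3 = 0 -> n 0 3 = 0 -> x 0 3 = 0 ->
  ip l l = -1 -> ip t t = 1 -> ip n n = 1 ->
  ip l t = 0 -> ip n l = 0 -> ip n t = 0 ->
  x = - ip x l *: l + ip x t *: t + ip x n *: n.
Proof.
move=> l3 t3 n3 x3 ll tt nn lt nl nt.
apply/eqP; rewrite -subr_eq0; apply/eqP; set y := x - _.
have y3 : y 0 3 = 0 by rewrite /y !mxE l3 t3 n3 x3; ring.
have yl : ip y l = 0 by rewrite /y !ipE ll (ipC t) lt nl; ring.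
have yt : ip y t = 0 by rewrite /y !ipE lt tt nt; ring.
have yn : ip y n = 0 by rewrite /y !ipE (ipC l) (ipC t) nl nt nn; ring.
move: {x3} y yl yt yn y3 => y; move: ll tt nn lt nl nt.
rewrite /ip l3 t3 n3 !(mul0r, mulr0, subr0) => ll tt nn lt nl nt yl yt yn y3.
set l0 := l 0 0 in ll lt nl yl; set l1 := l 0 1 in ll lt nl yl.
set l2 := l 0 2 in ll lt nl yl.
set t0 := t 0 0 in tt lt nt yt; set t1 := t 0 1 in tt lt nt yt.
set t2 := t 0 2 in tt lt nt yt.
set n0 := n 0 0 in nn nl nt yn; set n1 := n 0 1 in nn nl nt yn.
set n2 := n 0 2 in nn nl nt yn.
pose d := l0 * (t1 * n2 - t2 * n1) - l1 * (t0 * n2 - t2 * n0)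
          + l2 * (t0 * n1 - t1 * n0).
have dd : d ^+ 2 = 1.
  transitivity (- (l0 * l0 + l1 * l1 - l2 * l2)
     * ((t0 * t0 + t1 * t1 - t2 * t2) * (n0 * n0 + n1 * n1 - n2 * n2)
        - (n0 * t0 + n1 * t1 - n2 * t2) ^+ 2)
     + (l0 * t0 + l1 * t1 - l2 * t2)
     * ((l0 * t0 + l1 * t1 - l2 * t2) * (n0 * n0 + n1 * n1 - n2 * n2)
        - (n0 * t0 + n1 * t1 - n2 * t2) * (n0 * l0 + n1 * l1 - n2 * l2))
     - (n0 * l0 + n1 * l1 - n2 * l2)
     * ((l0 * t0 + l1 * t1 - l2 * t2) * (n0 * t0 + n1 * t1 - n2 * t2)
        - (t0 * t0 + t1 * t1 - t2 * t2) * (n0 * l0 + n1 * l1 - n2 * l2))).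
    by rewrite /d; ring.
  by rewrite ll tt nn lt nl nt; ring.
have d0 : d != 0 by apply: contra_eq_neq dd => ->; rewrite expr0n eq_sym oner_neq0.
have yE i c : d * y 0 i = c -> c = 0 -> y 0 i = 0.
  by move=> <- /eqP; rewrite mulf_eq0 (negPf d0) => /eqP.
apply: E42P; rewrite mxE //.
- apply: (yE _ ((t1 * n2 - t2 * n1) * (y 0 0 * l0 + y 0 1 * l1 - y 0 2 * l2)
    + (n1 * l2 - n2 * l1) * (y 0 0 * t0 + y 0 1 * t1 - y 0 2 * t2)
    + (l1 * t2 - l2 * t1) * (y 0 0 * n0 + y 0 1 * n1 - y 0 2 * n2))).
    by rewrite /d; ring.
  by rewrite yl yt yn; ring.
- apply: (yE _ ((t2 * n0 - t0 * n2) * (y 0 0 * l0 + y 0 1 * l1 - y 0 2 * l2)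
    + (n2 * l0 - n0 * l2) * (y 0 0 * t0 + y 0 1 * t1 - y 0 2 * t2)
    + (l2 * t0 - l0 * t2) * (y 0 0 * n0 + y 0 1 * n1 - y 0 2 * n2))).
    by rewrite /d; ring.
  by rewrite yl yt yn; ring.
- apply: (yE _ (- (t0 * n1 - t1 * n0) * (y 0 0 * l0 + y 0 1 * l1 - y 0 2 * l2)
    - (n0 * l1 - n1 * l0) * (y 0 0 * t0 + y 0 1 * t1 - y 0 2 * t2)
    - (l0 * t1 - l1 * t0) * (y 0 0 * n0 + y 0 1 * n1 - y 0 2 * n2))).
    by rewrite /d; ring.
  by rewrite yl yt yn; ring.
Qed.

Lemma is_derive_coord (R : realType) (l : R -> E42 R) (x : R) (dl : E42 R) i :
  is_derive x 1 l dl -> is_derive x 1 (fun s => l s 0 i) (dl 0 i).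
Proof.
move=> [hl <-]; have /derivable_mxP hl' := hl.
by apply: DeriveDef; [exact: hl'|rewrite derive_mx // mxE].
Qed.

Lemma is_derive_ip (R : realType) (l m : R -> E42 R) (x : R) (dl dm : E42 R) :
  is_derive x 1 l dl -> is_derive x 1 m dm ->
  is_derive x 1 (fun s => ip (l s) (m s)) (ip dl (m x) + ip (l x) dm).
Proof.
move=> hl hm.
have cM i : is_derive x 1 (fun s => l s 0 i * m s 0 i)
    (dl 0 i * m x 0 i + l x 0 i * dm 0 i).
  apply: is_derive_eq (is_deriveM (is_derive_coord i hl)
    (is_derive_coord i hm)) _.
  by rewrite /GRing.scale /=; ring.
apply: is_derive_eq (is_deriveB (is_deriveB (is_deriveD (cM 0) (cM 1)) (cM 2)) (cM 3)) _.
by rewrite /ip; ring.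
Qed.

Lemma is_derive_scalel (R : realType) (f : R -> R) (w : E42 R) (x df : R) :
  is_derive x 1 f df -> is_derive x 1 (fun s => f s *: w) (df *: w).
Proof.
move=> hf; have c i j : is_derive x 1 (fun s => (f s *: w) i j) (df * w i j).
  rewrite (_ : (fun s => (f s *: w) i j) = f * cst (w i j)); last first.
    by apply/funext => s; rewrite !mxE.
  by apply: is_derive_eq; rewrite /GRing.scale /=; ring.
have dw : derivable (fun s => f s *: w) x 1.
  by apply/derivable_mxP => i j; case: (c i j).
apply: DeriveDef; first exact: dw.
rewrite derive_mx //; apply/matrixP => i j; rewrite !mxE.
by case: (c i j).
Qed.

(** * The mean curvature of a meridian surface *)

Lemma derive1_val (R : realType) (V : normedModType R) (f : R -> V) (x : R) (d : V) :
  is_derive x 1 f d -> derive1 f x = d.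
Proof. by move=> [_ <-]; rewrite derive1E. Qed.

Lemma derive1_near_eq (R : realType) (V : normedModType R) (f k : R -> V) (x : R) :
  (\forall y \near x, f y = k y) -> derive1 f x = derive1 k x.
Proof. by rewrite !derive1E => fk; apply: near_eq_derive. Qed.

(** * The Frenet equation of the curve [l] *)

Section Frame.
Variables (R : realType) (J : set R) (l n : R -> E42 R).
Hypotheses (hJ : nondeg_interval J) (hl : unit_speed_curve J l)
  (hn : unit_normal_field J l n).

Lemma unit_speed_is_derive k v : J v ->
  is_derive v 1 (derive1n k l) (derive1n k.+1 l v).
Proof. by move=> Jv; have [/smooth_onP[U [_ JU] dl] _] := hl; exact/dl/JU. Qed.

Lemma unit_speed_ip v : J v -> [/\ ip (l v) (l v) = -1,
  ip (derive1 l v) (derive1 l v) = 1 & ip (l v) (derive1 l v) = 0].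
Proof.
move=> Jv; have [_ /(_ v Jv)[[[_ ll] _] tt]] := hl; split => //.
have dl := unit_speed_is_derive 0 Jv.
have : ip (derive1 l v) (l v) + ip (l v) (derive1 l v) = 0.
  apply: (is_derive_on_cst hJ Jv (is_derive_ip dl dl)) => y Jy.
  by have [_ /(_ y Jy)[[[_ lly] _] _]] := hl; rewrite /= lly ll.
by rewrite (ipC (derive1 l v)); lra.
Qed.

Lemma unit_speed_coord3 v : J v -> l v 0 3 = 0 /\ derive1 l v 0 3 = 0.
Proof.
have l3 y : J y -> l y 0 3 = 0.
  by move=> Jy; have [_ /(_ y Jy)[[[/E31_coord3 ->] _] _]] := hl.
move=> Jv; split; first exact: l3.
apply: (is_derive_on_cst hJ Jv (is_derive_coord 3 (unit_speed_is_derive 0 Jv))).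
by move=> y Jy; rewrite /= !l3.
Qed.

(** Differentiating <l,t> = 0 and <t,t> = 1 gives <t',l> = -1 and <t',t> = 0, while <t',n> is the
    curvature by definition. The term [+ l] has a plus sign because <l,l> = -1. *)
Lemma frenet v : J v -> derive1n 2 l v = curvature l n v *: n v + l v.
Proof.
move=> Jv; have [ll tt lt] := unit_speed_ip Jv.
have [l3 t3] := unit_speed_coord3 Jv.
have [_ /(_ v Jv)[/E31_coord3 n3 nn nl nt]] := hn.
have dl := unit_speed_is_derive 0 Jv; have dt := unit_speed_is_derive 1 Jv.
have x3 : derive1n 2 l v 0 3 = 0.
  apply: (is_derive_on_cst hJ Jv (is_derive_coord 3 dt)).
  by move=> y /unit_speed_coord3[_ t3y]; rewrite /= t3y t3.
have xl : ip (derive1n 2 l v) (l v) = -1.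
  have : ip (derive1 l v) (derive1 l v) + ip (l v) (derive1n 2 l v) = 0.
    apply: (is_derive_on_cst hJ Jv (is_derive_ip dl dt)) => y.
    by move=> /unit_speed_ip[_ _ lty]; rewrite /= lty lt.
  by rewrite tt (ipC (l v)); lra.
have xt : ip (derive1n 2 l v) (derive1 l v) = 0.
  have : ip (derive1n 2 l v) (derive1 l v) + ip (derive1 l v) (derive1n 2 l v) = 0.
    apply: (is_derive_on_cst hJ Jv (is_derive_ip dt dt)) => y.
    by move=> /unit_speed_ip[_ tty _]; rewrite /= tty tt.
  by rewrite (ipC (derive1 l v)); lra.
rewrite {1}(orthonormal_expansion l3 t3 n3 x3 ll tt nn lt nl nt).
by rewrite xl xt -/(curvature l n v) opprK scale1r scale0r addr0 addrC.
Qed.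

Lemma curvature_continuous v : J v -> {for v, continuous (curvature l n)}.
Proof.
move=> Jv; have [/smooth_onP[U [_ JU] dn] _] := hn.
have [hk _] := is_derive_ip (unit_speed_is_derive 2 Jv) (dn 0 v (JU v Jv)).
exact/differentiable_continuous/derivable1_diffP.
Qed.

End Frame.

(* The factor in
   h(Y, Y) - h(X, X) = (kappa / f) n + (meridian_defect / f) (g' l - f' e4). *)
Definition meridian_defect (R : realType) (f g : R -> R) (u : R) : R :=
  derive1 g u - f u * (derive1n 2 f u * derive1 g u - derive1 f u * derive1n 2 g u).

Section Meridian.
Variables (R : realType) (I : set R) (f g : R -> R).
Hypotheses (hI : nondeg_interval I) (hfg : meridian_curve I f g).

Lemma meridian_is_derive k u : I u ->
  is_derive u 1 (derive1n k f) (derive1n k.+1 f u) /\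
  is_derive u 1 (derive1n k g) (derive1n k.+1 g u).
Proof.
move=> Iu; have [/smooth_onP[U [_ IU] df] /smooth_onP[V [_ IV] dg] _] := hfg.
by split; [exact/df/IU|exact/dg/IV].
Qed.

Lemma meridian_deriv2 u : I u ->
  derive1 f u * derive1n 2 f u + derive1 g u * derive1n 2 g u = 0.
Proof.
move=> Iu; have [df dg] := meridian_is_derive 1 Iu.
have [_ _ h] := hfg; have [_ h1 _] := h u Iu.
have : derive1 f u * derive1n 2 f u + derive1 f u * derive1n 2 f u
   + (derive1 g u * derive1n 2 g u + derive1 g u * derive1n 2 g u) = 0.
  apply: (is_derive_on_cst hI Iu
    (is_deriveD (is_deriveM df df) (is_deriveM dg dg))) => y.
  by move=> /h[_ h1y _]; rewrite /= /GRing.add /GRing.mul /= -!expr2 h1y.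
by lra.
Qed.

End Meridian.

(** Here [(p, q)] and [(r, s)] are the coordinates of E1 and E2 for the metric diag(-1, F). The
    conclusion says that E1 E1^T - E2 E2^T is the inverse metric diag(-1, 1/F), so the trace of h
    does not depend on the frame. *)
Lemma lorentz_frame_trace (R : realType) (F p q r s : R) :
  0 < F -> - p ^+ 2 + F * q ^+ 2 = 1 -> - r ^+ 2 + F * s ^+ 2 = -1 ->
  - (p * r) + F * (q * s) = 0 ->
  [/\ p ^+ 2 - r ^+ 2 = -1, p * q - r * s = 0 & F * (q ^+ 2 - s ^+ 2) = 1].
Proof.
move=> F0 h1 h2 h12.
have pr : p ^+ 2 - r ^+ 2 = -1.
  (* Eliminating [q] and [s] turns this into (1 + p^2)(r^2 - 1) = (p r)^2, whose quartic terms
     cancel. *)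
  have : (F * q ^+ 2) * (F * s ^+ 2) = (F * (q * s)) ^+ 2 by ring.
  have -> : F * q ^+ 2 = 1 + p ^+ 2 by lra.
  have -> : F * s ^+ 2 = r ^+ 2 - 1 by lra.
  have -> : F * (q * s) = p * r by lra.
  by move=> h; nra.
split; [by [] | | lra].
have q0 : q != 0.
  apply/eqP => q0; move: h1; rewrite q0 expr0n mulr0 addr0.
  by have := sqr_ge0 p; lra.
have : F * q * (p * q - r * s) = 0.
  transitivity (p * (F * q ^+ 2) - r * (F * (q * s))); first by ring.
  have -> : F * q ^+ 2 = 1 + p ^+ 2 by lra.
  have -> : F * (q * s) = p * r by lra.
  transitivity (p * (1 + (p ^+ 2 - r ^+ 2))); first by ring.
  by rewrite pr; ring.
by move/eqP; rewrite !mulf_eq0 (negPf q0) gt_eqF //= => /eqP.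
Qed.

(** * Partial derivatives of the meridian surface *)

Section MeridianSurface.
Variables (R : realType) (I J : set R) (f g : R -> R) (l n : R -> E42 R).
Hypotheses (hI : nondeg_interval I) (hJ : nondeg_interval J)
  (hfg : meridian_curve I f g) (hl : unit_speed_curve J l)
  (hn : unit_normal_field J l n).

Local Notation z := (meridian_surface f g l).
Local Notation zu u v := (derive1 f u *: l v + derive1 g u *: e4 R).

Lemma meridian_surface_pdu u v : I u -> pdu z u v = zu u v.
Proof.
move=> Iu; have [df dg] := meridian_is_derive hfg 0 Iu; apply: derive1_val.
exact: is_deriveD (is_derive_scalel _ df) (is_derive_scalel _ dg).
Qed.

Lemma meridian_surface_pdv u v : J v -> pdv z u v = f u *: derive1 l v.
Proof.
move=> Jv; have dl := unit_speed_is_derive hl 0 Jv; apply: derive1_val.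
rewrite -[_ *: _]addr0.
exact: is_deriveD (is_deriveZ (f u) dl) (is_derive_cst (g u *: e4 R) v 1).
Qed.

Lemma meridian_surface_pduu u v : I u ->
  pdu (pdu z) u v = derive1n 2 f u *: l v + derive1n 2 g u *: e4 R.
Proof.
move=> Iu; have [/smooth_onP[U [oU IU] df] /smooth_onP[V [oV IV] dg] _] := hfg.
(* The outer derivative needs the formula for [pdu z] on a full neighbourhood of [u], which may
   leave [I]; the open sets on which [f] and [g] are smooth provide one. *)
have -> : pdu (pdu z) u v = derive1 (fun s => zu s v) u.
  apply: derive1_near_eq; have : (U `&` V) u by split; [exact: IU|exact: IV].
  move=> UVu; near=> s; apply: derive1_val.
  have [Us Vs] : (U `&` V) s.
    by near: s; apply: open_nbhs_nbhs; split => //; exact: openI.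
  exact: is_deriveD (is_derive_scalel _ (df 0 s Us)) (is_derive_scalel _ (dg 0 s Vs)).
have [d2f d2g] := meridian_is_derive hfg 1 Iu; apply: derive1_val.
exact: is_deriveD (is_derive_scalel _ d2f) (is_derive_scalel _ d2g).
Unshelve. all: by end_near. Qed.

Lemma meridian_surface_pduv u v : I u -> J v ->
  pdu (pdv z) u v = derive1 f u *: derive1 l v.
Proof.
move=> Iu Jv; have [df _] := meridian_is_derive hfg 0 Iu.
(* At a fixed [v] in [J] the formula for [pdv z] holds for every [s], so the two sides agree as
   functions of [s]. *)
rewrite /pdu (_ : (fun s => pdv z s v) = fun s => f s *: derive1 l v).
  by apply: derive1_val; exact: is_derive_scalel.
by apply/funext => s; exact: meridian_surface_pdv.
Qed.

Lemma meridian_surface_pdvv u v : J v ->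
  pdv (pdv z) u v = f u *: derive1n 2 l v.
Proof.
move=> Jv; have [/smooth_onP[U [oU JU] dl] _] := hl.
have -> : pdv (pdv z) u v = derive1 (fun s => f u *: derive1 l s) v.
  apply: derive1_near_eq; near=> s; apply: derive1_val.
  have Us : U s by near: s; apply: open_nbhs_nbhs; split => //; exact: JU.
  rewrite -[_ *: _]addr0.
  exact: is_deriveD (is_deriveZ (f u) (dl 0 s Us)) (is_derive_cst (g u *: e4 R) s 1).
have dt := is_deriveZ (f u) (unit_speed_is_derive hl 1 Jv).
by apply: derive1_val; exact: dt.
Unshelve. all: by end_near. Qed.

(** * Induced metric, mean curvature vector and quasi-minimality at a point *)

Section Point.
Variables (u v : R).
Hypotheses (Iu : I u) (Jv : J v).

Let fu := f u.
Let f1 := derive1 f u.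
Let g1 := derive1 g u.
Let f2 := derive1n 2 f u.
Let g2 := derive1n 2 g u.
Let k := curvature l n v.
Let G := meridian_defect f g u.

Lemma meridian_surface_tangent X :
  tangent z u v X = X.1 *: (f1 *: l v + g1 *: e4 R) + (X.2 * fu) *: derive1 l v.
Proof. by rewrite /tangent meridian_surface_pdu // meridian_surface_pdv // scalerA. Qed.

Lemma meridian_surface_ambient X Y : ambient_deriv z u v X Y =
  (X.1 * Y.1) *: (f2 *: l v + g2 *: e4 R)
  + ((X.1 * Y.2 + X.2 * Y.1) * f1) *: derive1 l v
  + (X.2 * Y.2 * fu) *: (k *: n v + l v).
Proof.
rewrite /ambient_deriv meridian_surface_pduu // meridian_surface_pduv //.
by rewrite meridian_surface_pdvv // -!scalerA (frenet hJ hl hn Jv).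
Qed.

Lemma meridian_ip : [/\ ip (e4 R) (e4 R) = -1, ip (e4 R) (l v) = 0,
  ip (e4 R) (derive1 l v) = 0 & ip (e4 R) (n v) = 0].
Proof.
have [l3 t3] := unit_speed_coord3 hJ hl Jv.
have [_ /(_ v Jv)[/E31_coord3 n3 _ _ _]] := hn.
by rewrite !ip_e4 l3 t3 n3 /e4 !mxE /= oppr0.
Qed.

Lemma meridian_surface_ip_tangent X Y :
  ip (tangent z u v X) (tangent z u v Y) = - (X.1 * Y.1) + fu ^+ 2 * (X.2 * Y.2).
Proof.
have [ll tt lt] := unit_speed_ip hJ hl Jv; have [ee el et en] := meridian_ip.
have [_ _ /(_ u Iu)[_ fg1 _]] := hfg.
rewrite !meridian_surface_tangent !ipE (ipC _ (e4 R)) (ipC (derive1 l v)).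
rewrite (ipC _ (e4 R)) ll tt lt ee el et.
have -> : - (X.1 * Y.1) = - (X.1 * Y.1) * (f1 ^+ 2 + g1 ^+ 2) by rewrite fg1 mulr1.
by ring.
Qed.

(** For an arbitrary Lorentz frame, the trace identities reduce [h1 - h2] to - z_uu + z_vv / f^2
    minus a tangent vector, and orthogonality to z_u and z_v determines that vector. The converse
    exhibits one frame. *)
Lemma meridian_mean_curvatureP H : mean_curvature_vector z u v H <->
  H = 2^-1 *: ((k / fu) *: n v + (G / fu) *: (g1 *: l v - f1 *: e4 R)).
Proof.
have [ll tt lt] := unit_speed_ip hJ hl Jv; have [ee el et en] := meridian_ip.
have [_ /(_ v Jv)[_ nn nl nt]] := hn.
have [_ _ /(_ u Iu)[fu0 fg1 _]] := hfg.
have fg2 := meridian_deriv2 hI hfg Iu.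
have fu2 : 0 < fu ^+ 2 by rewrite exprn_even_gt0.
have ee' := (ipC (l v) (e4 R), ipC (derive1 l v) (e4 R), ipC (n v) (e4 R)).
have tl : ip (derive1 l v) (l v) = 0 by rewrite ipC.
have ln : ip (l v) (n v) = 0 by rewrite ipC.
have tn : ip (derive1 l v) (n v) = 0 by rewrite ipC.
have ipv := (ll, tt, lt, ee', ee, el, et, en, nn, nl, nt, tl, ln, tn).
split.
- move=> [[p q] [[r s] [h1 [h2 [[]]]]]].
  rewrite !meridian_surface_ip_tangent /= -!expr2 => E11 E22 E12.
  move=> [h1n [[a1 b1] h1E]] [h2n [[a2 b2] h2E]] ->; congr (_ *: _).
  have [pr pqrs qs] := lorentz_frame_trace fu2 E11 E22 E12.
  have DE : h1 - h2 = - (f2 *: l v + g2 *: e4 R) + fu^-1 *: (k *: n v + l v)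
      - ((a1 - a2) *: (f1 *: l v + g1 *: e4 R)
         + ((b1 - b2) * fu) *: derive1 l v).
    have qs' : fu * (q ^+ 2 - s ^+ 2) = fu^-1.
      by apply: (mulfI fu0); rewrite mulrA -expr2 qs divff.
    have sub_l (x y w : E42 R) : x = y + w -> w = x - y.
      by move=> ->; rewrite addrAC subrr add0r.
    rewrite (sub_l _ _ _ h1E) (sub_l _ _ _ h2E).
    rewrite !meridian_surface_ambient !meridian_surface_tangent /=.
    move: (e4 R) => e; apply/rowP => j; rewrite !mxE -qs'.
    transitivity ((p ^+ 2 - r ^+ 2) * (f2 * l v 0 j + g2 * e 0 j)
      + 2 * (p * q - r * s) * (f1 * derive1 l v 0 j)
      + fu * (q ^+ 2 - s ^+ 2) * (k * n v 0 j + l v 0 j)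
      - ((a1 - a2) * (f1 * l v 0 j + g1 * e 0 j)
        + (b1 - b2) * fu * derive1 l v 0 j)); first by ring.
    by rewrite pr pqrs; ring.
  (* [Db] comes from pairing with z_v / f = t, and [Da] from pairing with z_u. *)
  have Db : (b1 - b2) * fu = 0.
    have : ip (h1 - h2) (fu^-1 *: tangent z u v (0, 1)) = 0.
      by rewrite ipZr ipDl ipNl h1n h2n subrr mulr0.
    rewrite DE meridian_surface_tangent scale0r add0r scalerA mul1r mulVf // scale1r.
    by rewrite !ipE !ipv; lra.
  have Da : a1 - a2 = f1 / fu.
    have : ip (h1 - h2) (tangent z u v (1, 0)) = 0.
      by rewrite ipDl ipNl h1n h2n subrr.
    rewrite DE meridian_surface_tangent scale1r mul0r scale0r addr0 !ipE !ipv => h.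
    have : f1 * f2 + g1 * g2 - f1 / fu + (a1 - a2) * (f1 ^+ 2 + g1 ^+ 2) = 0.
      by rewrite -h; ring.
    by rewrite fg1 fg2; lra.
  rewrite DE Da Db scale0r addr0.
  (* What remains are the coefficients of [l] and [e4]. Inserting f'^2 + g'^2 = 1 and adding a
     multiple of f' f'' + g' g'' = 0 turns each equation into an identity of rational functions. *)
  have cl : - f2 + fu^-1 - f1 / fu * f1 = G / fu * g1.
    transitivity (fu^-1 * (f1 ^+ 2 + g1 ^+ 2) - f2 * (f1 ^+ 2 + g1 ^+ 2)
      - f1 / fu * f1 + f1 * (f1 * f2 + g1 * g2)); first by rewrite fg1 fg2; ring.
    by rewrite /G /meridian_defect -/fu -/f1 -/g1 -/f2 -/g2; field.
  have ce : - g2 - f1 / fu * g1 = - (G / fu * f1).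
    transitivity (- g2 * (f1 ^+ 2 + g1 ^+ 2) - f1 / fu * g1
      + g1 * (f1 * f2 + g1 * g2)); first by rewrite fg1 fg2; ring.
    by rewrite /G /meridian_defect -/fu -/f1 -/g1 -/f2 -/g2; field.
  move: (e4 R) => e; apply/rowP => j; rewrite !mxE.
  transitivity (k / fu * n v 0 j + (- f2 + fu^-1 - f1 / fu * f1) * l v 0 j
    + (- g2 - f1 / fu * g1) * e 0 j); first by ring.
  by rewrite cl ce; ring.
- move=> ->.
  have Nzu : ip (g1 *: l v - f1 *: e4 R) (f1 *: l v + g1 *: e4 R) = 0.
    by rewrite !ipE !ipv; ring.
  (* The frame is Y = z_v / f, X = z_u. With N = g' l - f' e4, the next two witnesses are h(Y, Y)
     and h(X, X) = (f'' g' - f' g'') N. The tangential part of D_Y Y is (f' / f) X, and that of D_X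
     X is zero. *)
  exists (0, fu^-1), (1, 0).
  exists ((k / fu) *: n v + (g1 / fu) *: (g1 *: l v - f1 *: e4 R)).
  exists ((f2 * g1 - f1 * g2) *: (g1 *: l v - f1 *: e4 R)).
  split.
  + split; rewrite meridian_surface_ip_tangent /=; last by ring.
      by field.
    by ring.
  + split=> [X|].
      rewrite meridian_surface_tangent ipDr (ipZr X.1) (ipDl _ _ (_ + _)).
      rewrite (ipZl (g1 / fu)) Nzu !ipE !ipv; ring.
    exists (f1 / fu, 0); rewrite meridian_surface_ambient meridian_surface_tangent /=.
    move: (e4 R) => e; apply/rowP => j; rewrite !mxE.
    transitivity (fu^-1 * (k * n v 0 j + l v 0 j)); first by field.
    transitivity (k / fu * n v 0 j + fu^-1 * (f1 ^+ 2 + g1 ^+ 2) * l v 0 j).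
      by rewrite fg1; ring.
    by ring.
  + split=> [X|].
      rewrite meridian_surface_tangent ipDr (ipZr X.1) (ipZl (_ - _)) Nzu.
      by rewrite !ipE !ipv; ring.
    exists (0, 0); rewrite meridian_surface_ambient meridian_surface_tangent /=.
    move: (e4 R) => e; apply/rowP => j; rewrite !mxE.
    transitivity ((f2 * (f1 ^+ 2 + g1 ^+ 2) - f1 * (f1 * f2 + g1 * g2)) * l v 0 j
      + (g2 * (f1 ^+ 2 + g1 ^+ 2) - g1 * (f1 * f2 + g1 * g2)) * e 0 j).
      by rewrite fg1 fg2; ring.
    by ring.
  + congr (_ *: _); move: (e4 R) => e; apply/rowP => j; rewrite !mxE.
    rewrite /G /meridian_defect -/fu -/f1 -/g1 -/f2 -/g2; field.
    by [].
Qed.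

(** <H,H> is a nonzero multiple of kappa^2 - G^2, so it vanishes iff kappa^2 = G^2. Under this
    equality kappa = 0 forces G = 0 and H = 0, whereas kappa != 0 gives H != 0 because <H,n> = kappa
    / (2 f). *)
Lemma meridian_quasi_minimalP :
  (exists2 H, mean_curvature_vector z u v H & lightlike H) <->
  k != 0 /\ k ^+ 2 = G ^+ 2.
Proof.
have [ll tt lt] := unit_speed_ip hJ hl Jv; have [ee el et en] := meridian_ip.
have [_ /(_ v Jv)[_ nn nl nt]] := hn.
have [_ _ /(_ u Iu)[fu0 fg1 _]] := hfg.
set H0 := 2^-1 *: ((k / fu) *: n v + (G / fu) *: (g1 *: l v - f1 *: e4 R)).
have HH : ip H0 H0 = (2 * fu) ^- 2 * (k ^+ 2 - G ^+ 2).
  rewrite /H0 !ipE (ipC (l v)) (ipC _ (e4 R)) (ipC _ (e4 R)) ll ee el en nn nl.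
  transitivity ((2 * fu) ^- 2 * (k ^+ 2 - G ^+ 2 * (f1 ^+ 2 + g1 ^+ 2))); last first.
    by rewrite fg1 mulr1.
  by field.
have Hn : ip H0 (n v) = k / (2 * fu).
  by rewrite /H0 !ipE (ipC (l v)) en nn nl; field.
have fu4 : (2 * fu) ^- 2 != 0 by rewrite invr_eq0 expf_neq0 // mulf_neq0.
split=> [[H /meridian_mean_curvatureP -> [H00]]|[k0 kG]].
  rewrite -/H0 HH => /eqP; rewrite mulf_eq0 (negPf fu4) /= subr_eq0 => /eqP kG.
  split=> //; apply/eqP => k0; apply: H00; move: kG.
  rewrite k0 expr0n => /esym/eqP; rewrite sqrf_eq0 => /eqP ->.
  by rewrite !mul0r !scale0r addr0 scaler0.
exists H0; first exact/meridian_mean_curvatureP.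
split; last by rewrite HH kG subrr mulr0.
move=> H00; move: Hn; rewrite H00 /ip !mxE !mul0r !subr0 addr0 => /esym/eqP.
by rewrite mulf_eq0 invr_eq0 mulf_eq0 (negPf k0) (negPf fu0) pnatr_eq0.
Qed.

End Point.
End MeridianSurface.

(** * The equation of the meridian *)

Section MeridianEquation.
Variables (R : realType) (I : set R) (f g : R -> R).
Hypotheses (hI : nondeg_interval I) (hfg : meridian_curve I f g).

Lemma meridian_defect_continuous u : I u -> {for u, continuous (meridian_defect f g)}.
Proof.
move=> Iu; have dfg k := meridian_is_derive hfg k Iu.
have [[df dg] [d1f d1g] [d2f d2g]] := And3 (dfg 0) (dfg 1) (dfg 2).
have [hG _] := is_deriveB d1g (is_deriveM df (is_deriveB (is_deriveM d2f d1g)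
  (is_deriveM d1f d2g))).
exact/differentiable_continuous/derivable1_diffP.
Qed.

(** The two relations f'^2 + g'^2 = 1 and f' f'' + g' g'' = 0 give g'' = - f' (f'' g' - f' g''),
    which pulls the factor f' out of (f g')' = f' g' + f g''. *)
Lemma meridian_first_integral_is_derive (b u : R) : I u ->
  is_derive u 1 (fun s => f s * derive1 g s - b * f s)
    (derive1 f u * (meridian_defect f g u - b)).
Proof.
move=> Iu; have [df dg] := meridian_is_derive hfg 0 Iu.
have [d1f d1g] := meridian_is_derive hfg 1 Iu.
apply: is_derive_eq (is_deriveB (is_deriveM df d1g) (is_deriveZ b df)) _.
have fg2 := meridian_deriv2 hI hfg Iu.
have [_ _ /(_ u Iu)[_ fg1 _]] := hfg.
rewrite /GRing.scale /= /meridian_defect.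
set f1 := derive1 f u in fg1 fg2 *; set g1 := derive1 g u in fg1 fg2 *.
set f2 := derive1n 2 f u in fg2 *; set g2 := derive1n 2 g u in fg2 *.
rewrite -[derive1 (derive1 g) u]/g2.
transitivity (f u * g2 * (f1 ^+ 2 + g1 ^+ 2) - f u * g1 * (f1 * f2 + g1 * g2)
  + g1 * f1 - b * f1); last by ring.
by rewrite fg1 fg2; ring.
Qed.

Lemma sqrt_one_minus_sqr u : I u -> derive1 g u = Num.sqrt (1 - derive1 f u ^+ 2).
Proof.
move=> Iu; have [_ _ /(_ u Iu)[_ <- g0]] := hfg.
by rewrite addrAC subrr add0r sqrtr_sqr gtr0_norm.
Qed.

(** By continuity the defect is a constant [b] equal to a or -a, which fixes the inner sign, and [c]
    is the constant value of f g' - b f. The radicand is then (f f')^2. *)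
Lemma defect_determined_by_phi a :
  (forall u, I u -> meridian_defect f g u ^+ 2 = a ^+ 2) ->
  meridian_determined_by_phi I f g a.
Proof.
move=> hG; have [intI [u0 [_ [Iu0 _ _]]]] := hI.
have Gcst := sqr_cst_cst intI meridian_defect_continuous hG.
set b := meridian_defect f g u0.
have Gb u : I u -> meridian_defect f g u = b by move=> Iu; exact: Gcst.
have [inner bE] : exists inner : bool, (-1) ^+ inner * a = b.
  have /eqP := hG u0 Iu0; rewrite -/b eqf_sqr => /orP[] /eqP ->.
    by exists false; rewrite expr0 mul1r.
  by exists true; rewrite expr1 mulN1r.
set c := f u0 * derive1 g u0 - b * f u0.
have fgc u : I u -> c + b * f u = f u * derive1 g u.
  move=> Iu; rewrite /c; set h := fun s => f s * derive1 g s - b * f s.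
  suff : h u0 = h u by rewrite /h => ->; rewrite subrK.
  apply: (derive_eq0_cst intI) => // s Is.
  apply: is_derive_eq (meridian_first_integral_is_derive b Is) _.
  by rewrite Gb // subrr mulr0.
have rE u : I u -> radicand inner a c (f u) = (f u * derive1 f u) ^+ 2.
  move=> Iu; have [_ _ /(_ u Iu)[_ fg1 _]] := hfg.
  rewrite /radicand mulrA bE fgc // !exprMn.
  have -> : derive1 f u ^+ 2 = 1 - derive1 g u ^+ 2 by rewrite -fg1 addrK.
  by ring.
exists c, inner; split.
- move=> u Iu; have [_ _ /(_ u Iu)[fu0 _ _]] := hfg.
  rewrite /phi rE // sqr_ge0 sqrtr_sqr; split=> //.
  (* The square root is |f f'|, so the outer sign is the sign of f f' at [u]. *)
  have [ff|ff] := leP 0 (f u * derive1 f u).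
    by exists false; rewrite expr0 mul1r ger0_norm // mulKf.
  by exists true; rewrite expr1 mulN1r ltr0_norm // mulrN opprK mulKf.
- exact: sqrt_one_minus_sqr.
(* If f' vanished on all of [I], then f'' = 0 and g' = 1, so the defect [b] would be 1 and c = f - f
   = 0. *)
- move=> c0; apply: contrapT => h; move/eqP: c0; apply.
  have f10 u : I u -> derive1 f u = 0.
    by move=> Iu; apply/eqP/negPn/negP => f1; apply: h; exists u.
  have g11 u : I u -> derive1 g u = 1.
    by move=> Iu; rewrite sqrt_one_minus_sqr // f10 // expr0n subr0 sqrtr1.
  have d1f := (meridian_is_derive hfg 1 Iu0).1.
  have f20 : derive1n 2 f u0 = 0.
    by apply: (is_derive_on_cst hI Iu0 d1f) => y Iy; rewrite /= !f10.
  rewrite /c /b /meridian_defect f20 f10 // g11 //; ring.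
Qed.

(* Differentiating f g' = +- (c +- a f) only gives the defect where f' <> 0.
   Elsewhere either f' is nonzero arbitrarily close, or f'' = 0 and the defect
   is 1; continuity of the defect then selects one case on all of I. *)
Lemma determined_by_phi_defect a :
  meridian_determined_by_phi I f g a ->
  forall u, I u -> meridian_defect f g u ^+ 2 = a ^+ 2.
Proof.
move=> [c [inner [hphi _ hc]]]; have [intI [u0 [_ [Iu0 _ _]]]] := hI.
have [_ _ hfg'] := hfg.
set b := (-1) ^+ inner * a.
have b2 : b ^+ 2 = a ^+ 2 by rewrite /b exprMn sqrr_sign mul1r.
(* Squaring f' = phi(f) removes the outer sign, which may vary with [u]; nonnegativity of the
   radicand makes the square of its root equal to it. *)
have sqE u : I u -> (c + b * f u) ^+ 2 = (f u * derive1 g u) ^+ 2.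
  move=> Iu; have [rad0 [outer f1E]] := hphi u Iu.
  have [fu0 fg1 _] := hfg' u Iu.
  have : (f u * derive1 f u) ^+ 2 = radicand inner a c (f u).
    rewrite f1E /phi mulrCA mulVKf // exprMn sqrr_sign mul1r.
    by rewrite sqr_sqrtr.
  rewrite /radicand mulrA -/b => h.
  transitivity (f u ^+ 2 - (f u * derive1 f u) ^+ 2); first by rewrite h; ring.
  have gE : derive1 g u ^+ 2 = 1 - derive1 f u ^+ 2 by rewrite -fg1 addrAC subrr add0r.
  by rewrite !exprMn gE; ring.
have fg0 u : I u -> f u * derive1 g u != 0.
  by move=> Iu; have [fu0 _ g0] := hfg' u Iu; rewrite mulf_neq0 // gt_eqF.
(* The sign [d] relating f g' to c + b f is the same on all of [I]: their ratio is continuous, since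
   f g' never vanishes, and has square 1. *)
have [d d2 dE] : exists2 d, d ^+ 2 = 1 &
    forall u, I u -> f u * derive1 g u = d * c + d * b * f u.
  pose r u := (c + b * f u) / (f u * derive1 g u).
  have r2 u : I u -> r u ^+ 2 = 1.
    by move=> Iu; rewrite expr_div_n sqE // divff // expf_neq0 // fg0.
  have rcont u : I u -> {for u, continuous r}.
    move=> Iu; have [df _] := meridian_is_derive hfg 0 Iu.
    have [_ d1g] := meridian_is_derive hfg 1 Iu.
    have num : {for u, continuous (fun s => c + b * f s)}.
      have [h _] := is_deriveD (is_derive_cst c u 1) (is_deriveZ b df).
      exact/differentiable_continuous/derivable1_diffP.
    have den : {for u, continuous (fun s => f s * derive1 g s)}.
      have [h _] := is_deriveM df d1g.
      exact/differentiable_continuous/derivable1_diffP.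
    exact: cvgM num (cvgV (fg0 u Iu) den).
  have rcst := sqr_cst_cst intI rcont r2.
  exists (r u0); first exact: r2.
  move=> u Iu; rewrite (rcst u0 u) //.
  transitivity (r u ^+ 2 * (f u * derive1 g u)); first by rewrite r2 // mul1r.
  by rewrite /r; field; have [-> _ /gt_eqF->] := hfg' u Iu.
set be := d * b in dE.
have f1G u : I u -> derive1 f u * (meridian_defect f g u - be) = 0.
  move=> Iu; apply: (is_derive_on_cst hI Iu (meridian_first_integral_is_derive be Iu)).
  by move=> y Iy; rewrite !dE //; ring.
have g11 u : I u -> derive1 f u = 0 -> derive1 g u = 1.
  by move=> Iu f10; rewrite sqrt_one_minus_sqr // f10 expr0n subr0 sqrtr1.
have G2 u : I u -> meridian_defect f g u = be \/ meridian_defect f g u = 1.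
  move=> Iu; have [->|GE] := eqVneq (meridian_defect f g u) be; [by left|right].
  have f10 : derive1 f u = 0.
    by have /eqP := f1G u Iu; rewrite mulf_eq0 subr_eq0 (negPf GE) orbF => /eqP.
  have f20 : derive1n 2 f u = 0.
    apply: (is_derive_within_cst hI Iu (meridian_is_derive hfg 1 Iu).1).
    rewrite /= f10.
    have Gne : \forall y \near u, meridian_defect f g y - be != 0.
      have cB : meridian_defect f g y - be @[y --> u] --> meridian_defect f g u - be.
        by apply: cvgB; [exact: meridian_defect_continuous|exact: cvg_cst].
      by apply: (cvgr_neq0 _ cB); rewrite subr_eq0.
    apply: filterS Gne => y Gy Iy; have /eqP := f1G y Iy.
    by rewrite mulf_eq0 (negPf Gy) orbF => /eqP.
  by rewrite /meridian_defect f20 f10 g11 //; ring.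
have Gcst := two_valued_cst intI meridian_defect_continuous G2.
move=> u Iu; suff -> : meridian_defect f g u = be.
  by rewrite /be exprMn d2 mul1r.
(* A defect different from [be] at one point differs from it everywhere, so f' = 0 on [I]. The last
   clause of the definition then leaves only c = 0, where f g' = be f with g' = 1 gives be = 1, the
   other admissible value of the defect. *)
apply/eqP/negPn/negP => GE.
have f10 y : I y -> derive1 f y = 0.
  move=> Iy; have /eqP := f1G y Iy.
  by rewrite mulf_eq0 subr_eq0 (Gcst y u) // (negPf GE) orbF => /eqP.
have [c0|/hc[y Iy /eqP]] := eqVneq c 0; last by apply; exact: f10.
have [fu0 _ _] := hfg' u Iu.
have := dE u Iu; rewrite g11 ?f10 // c0 mulr0 add0r mulrC => /(mulIf fu0) be1.
by move: GE; case: (G2 u Iu) => ->; rewrite ?be1 eqxx.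
Qed.

End MeridianEquation.

(** * Separation of the variables [u] and [v] *)

Theorem theorem7 (R : realType) (I J : set R) (f g : R -> R)
    (l n : R -> E42 R)
    (hI : nondeg_interval I) (hJ : nondeg_interval J)
    (hfg : meridian_curve I f g)
    (hl : unit_speed_curve J l) (hn : unit_normal_field J l n) :
  quasi_minimal I J (meridian_surface f g l) <->
  exists a : R,
    [/\ a != 0,
        forall v, J v -> curvature l n v = a &
        meridian_determined_by_phi I f g a].
Proof.
have [intJ [v0 [_ [Jv0 _ _]]]] := hJ; have [_ [u0 [_ [Iu0 _ _]]]] := hI.
split=> [qm|[a [a0 ka hphi]] u v Iu Jv].
  have kG u v : I u -> J v ->
      curvature l n v != 0 /\ curvature l n v ^+ 2 = meridian_defect f g u ^+ 2.
    by move=> Iu Jv; apply/(meridian_quasi_minimalP hI hJ hfg hl hn Iu Jv)/qm.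
  exists (curvature l n v0); split; first by have [] := kG u0 v0 Iu0 Jv0.
  - move=> v Jv.
    (* Fixing [u0] makes kappa^2 constant in v, and continuity of kappa excludes a change of sign;
       fixing [v0] in the next item makes the squared defect constant in u. *)
    apply: (sqr_cst_cst intJ (curvature_continuous hl hn) _ Jv Jv0) => w Jw.
    by have [_ ->] := kG u0 w Iu0 Jw.
  - apply: (defect_determined_by_phi hI hfg) => u Iu.
    by have [_ ->] := kG u v0 Iu Jv0.
apply/(meridian_quasi_minimalP hI hJ hfg hl hn Iu Jv).
by rewrite ka // (determined_by_phi_defect hI hfg hphi Iu).
Qed.
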